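(* Let $m,N$ be positive integers with $m\le N$. There is a constant $C=C(m,N)$ such that the following holds. Let $s$ be a positive integer with $m\mid s$, and let $\mathbb{F}$ be a field containing a primitive $s$-th root of unity $\omega_s$, with $|\mathbb{F}|\ge N$ if $\mathbb{F}$ is finite. Consider the distributed Fourier transform problem of computing $X=\mathcal{F}\{x\}$, $x\in\mathbb{F}^s$, using $N$ workers that can each store and process a $\frac1m$ fraction of the input. Then there exists a computation strategy whose recovery threshold equals $K^*=m$, and which allows efficient decoding, with complexity linear in the input size $s$: for every set of $m$ workers, the master can recover $X$ from the results of these $m$ workers using at most $C\cdot s$ arithmetic operations in $\mathbb{F}$.
   Context: Discrete Fourier transform: for $x=(x_0,\dots,x_{s-1})\in\mathbb{F}^s$, $X=\mathcal{F}\{x\}\in\mathbb{F}^s$ is defined by $X_i=\sum_{j=0}^{s-1}x_j\,\omega_s^{ij}$ for $i\in\{0,\dots,s-1\}$. Computation strategy: a tuple of $N$ encoding functions $f_0,\dots,f_{N-1}$ and $N$ computing functions $g_0,\dots,g_{N-1}$, where $f_i:\mathbb{F}^s\to\mathbb{F}^{s/m}$ and $g_i:\mathbb{F}^{s/m}\to\mathbb{F}^{s/m}$ are arbitrary functions. On input $x$, worker $i$ stores $a_i=f_i(x)\in\mathbb{F}^{s/m}$, computes $b_i=g_i(a_i)\in\mathbb{F}^{s/m}$, and returns $b_i$ to the master. Recoverability: for an integer $k\in\{0,\dots,N\}$, a computation strategy is $k$-recoverable if for every set $S\subseteq\{0,\dots,N-1\}$ with $|S|=k$ there is a decoding function $d_S$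 such that $d_S\big((b_i)_{i\in S}\big)=\mathcal{F}\{x\}$ for all $x\in\mathbb{F}^s$. The recovery threshold of a computation strategy is the minimum $k$ for which it is $k$-recoverable. Decoding complexity: the number of arithmetic operations is the number of additions, subtractions and multiplications in $\mathbb{F}$ (each counted as one operation) in a straight-line program that computes $d_S$ from the entries of the $b_i$, $i\in S$. Fixed constants of $\mathbb{F}$ that do not depend on the input $x$ (such as powers of $\omega_s$) may be used freely. *)

(* Defs.v *)
From HB Require Import structures.
From mathcomp Require Import all_boot all_order all_algebra.

Set Implicit Arguments.
Unset Strict Implicit.
Unset Printing Implicit Defensive.

Import GRing.Theory.
Local Open Scope ring_scope.

Definition dft (F : fieldType) (s : nat) (w : F) (x : 'rV[F]_s) : 'rV[F]_s :=
  \row_(i < s) \sum_(j < s) x 0 j * w ^+ (i * j).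

(* Only meaningful when m divides s: s %/ m is then the exact quotient s/m. *)
Record strategy (F : fieldType) (N m s : nat) := Strategy {
  encode : 'I_N -> 'rV[F]_s -> 'rV[F]_(s %/ m);
  compute : 'I_N -> 'rV[F]_(s %/ m) -> 'rV[F]_(s %/ m)
}.

Definition worker_output (F : fieldType) (N m s : nat) (st : strategy F N m s)
    (x : 'rV[F]_s) (i : 'I_N) : 'rV[F]_(s %/ m) :=
  compute st i (encode st i x).

(* The families (b_i)_(i in S). *)
Definition results (F : fieldType) (N m s : nat) (S : {set 'I_N}) :=
  {ffun {i : 'I_N | i \in S} -> 'rV[F]_(s %/ m)}.

Definition decodes (F : fieldType) (N m s : nat) (w : F)
    (st : strategy F N m s) (S : {set 'I_N})
    (d : results F m s S -> 'rV[F]_s) : Prop :=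
  forall x : 'rV[F]_s, d [ffun i => worker_output st x (val i)] = dft w x.

Definition recoverable (F : fieldType) (N m s : nat) (w : F)
    (st : strategy F N m s) (k : nat) : Prop :=
  forall S : {set 'I_N}, #|S| = k ->
    exists d : results F m s S -> 'rV[F]_s, decodes w st d.

(* k ranges over {0, ..., N}; for k > N [recoverable] would hold vacuously. *)
Definition is_recovery_threshold (F : fieldType) (N m s : nat) (w : F)
    (st : strategy F N m s) (k : nat) : Prop :=
  [/\ (k <= N)%N, recoverable w st k &
      forall k' : nat, (k' <= N)%N -> recoverable w st k' -> (k <= k')%N].

Inductive arith_op := OpAdd | OpSub | OpMul.

(* [Reg k] is the result of the k-th instruction, counting from 0. *)
Inductive operand (F I : Type) :=
  | Const of F
  | Input of I
  | Reg of nat.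

Record instruction (F I : Type) := Instruction {
  instr_op : arith_op;
  instr_left : operand F I;
  instr_right : operand F I
}.

(* Straight-line programs over F with inputs indexed by I and n outputs. *)
Record slp (F I : Type) (n : nat) := Slp {
  slp_code : seq (instruction F I);
  slp_out : 'I_n -> operand F I
}.

(* Constants, inputs and outputs are free, so each instruction costs 1 and
   nothing else does. *)
Definition slp_cost (F I : Type) (n : nat) (p : slp F I n) : nat :=
  size (slp_code p).

Definition arith_eval (F : fieldType) (o : arith_op) (a b : F) : F :=
  match o with
  | OpAdd => a + b
  | OpSub => a - b
  | OpMul => a * b
  end.

(* A reference to a register not yet computed reads the constant 0; since
   constants are free, such references give no additional power. *)
Definition operand_eval (F : fieldType) (I : Type) (inp : I -> F)
    (regs : seq F) (u : operand F I) : F :=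
  match u with
  | Const c => c
  | Input i => inp i
  | Reg k => nth 0 regs k
  end.

Definition step (F : fieldType) (I : Type) (inp : I -> F) (regs : seq F)
    (c : instruction F I) : seq F :=
  rcons regs (arith_eval (instr_op c) (operand_eval inp regs (instr_left c))
                                      (operand_eval inp regs (instr_right c))).

Definition slp_eval (F : fieldType) (I : Type) (n : nat) (p : slp F I n)
    (inp : I -> F) : 'rV[F]_n :=
  \row_(j < n) operand_eval inp (foldl (step inp) [::] (slp_code p))
                            (slp_out p j).

(* The input (i, l) is the l-th entry of b_i. *)
Definition slp_computes (F : fieldType) (N m s : nat) (S : {set 'I_N})
    (p : slp F ({i : 'I_N | i \in S} * 'I_(s %/ m)) s)
    (d : results F m s S -> 'rV[F]_s) : Prop :=
  forall y : results F m s S, slp_eval p (fun il => y il.1 0 il.2) = d y.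

(* Main.v *)
Require Import Defs.
From HB Require Import structures.
From mathcomp Require Import all_boot all_order all_algebra.
From Stdlib Require Classical.

Set Implicit Arguments.
Unset Strict Implicit.
Unset Printing Implicit Defensive.

Import GRing.Theory.
Local Open Scope ring_scope.

(** Put t = s/m and let P_l(z), for l < t, be the polynomial of degree < m whose
    j-th coefficient is the l-th entry of the length-t transform of the
    interleaved block (x_j, x_(m+j), x_(2m+j), ...). Worker i evaluates all the
    P_l at its own point a_i: by linearity it may evaluate first, on the raw
    blocks, and transform afterwards. One step of the Cooley-Tukey recursion
    reads X_k = P_(k mod t)(w^k), so Lagrange interpolation expresses X_k as a
    fixed linear combination of the entries number k mod t of any m results,
    i.e. with 2m operations. Conversely, given a set S of fewer than m workers,
    the coefficients of q = prod_(i in S) (z - a_i) form a nonzero input on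
    which all workers of S return 0, although X_k = q(w^k) is not always 0. *)

(** * Distinct evaluation points and Lagrange interpolation *)

Lemma uniq_seq_of_enum_bound (T : eqType) (n : nat) :
  (forall e : seq T, Finite.axiom e -> (n <= size e)%N) ->
  exists2 u : seq T, uniq u & size u = n.
Proof.
move=> enumP; suff /(_ n (leqnn n)) : forall k, (k <= n)%N ->
  exists2 u : seq T, uniq u & size u = k by [].
elim=> [|k IHk] ltkn; first by exists [::].
have [u Uu szu] := IHk (ltnW ltkn).
(* [T] may be infinite, so whether [u] exhausts it is decided classically. If it does, [u] is an
   enumeration and [enumP] contradicts its size being k < n. *)
have [[x xNu]|all_u] := Classical_Prop.classic (exists x, x \notin u).
  by exists (x :: u); rewrite /= ?xNu ?szu.
have/enumP : Finite.axiom u.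
  move=> x; rewrite count_uniq_mem //; case: (boolP (x \in u)) => // xNu.
  by case: all_u; exists x.
by rewrite szu leqNgt ltkn.
Qed.

Definition lagrange_weight (F : fieldType) (I : finType) (a : I -> F) (z : F)
    (i : I) : F :=
  \prod_(j | j != i) ((a i - a j)^-1 * (z - a j)).

(** The difference between p and its interpolant has size at most [#|I|] but vanishes at [#|I|]
    distinct nodes, hence is zero. *)
Lemma lagrange_horner (F : fieldType) (I : finType) (a : I -> F)
    (p : {poly F}) (z : F) :
    injective a -> (size p <= #|I|)%N ->
  p.[z] = \sum_i lagrange_weight a z i * p.[a i].
Proof.
move=> a_inj szp.
pose L i : {poly F} := \prod_(j | j != i) ((a i - a j)^-1 *: ('X - (a j)%:P)).
have LE i y : (L i).[y] = lagrange_weight a y i.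
  by rewrite horner_prod; apply: eq_bigr => j _; rewrite hornerZ hornerXsubC.
pose q := p - \sum_i p.[a i] *: L i.
have szL i : (size (L i) <= #|I|)%N.
  rewrite /L scaler_prod (leq_trans (size_scale_leq _ _)) //.
  rewrite -big_filter size_prod_XsubC size_filter -sum1_count sum1_card.
  by rewrite cardC1 prednK //; apply/card_gt0P; exists i.
have szq : (size q <= #|I|)%N.
  rewrite (leq_trans (size_polyD _ _)) // geq_max szp size_polyN /=.
  rewrite (leq_trans (size_sum _ _ _)) //; apply/bigmax_leqP => i _.
  exact: leq_trans (size_scale_leq _ _) (szL i).
have rootq i : q.[a i] = 0.
  rewrite hornerD hornerN horner_sum (bigD1 i) //= big1 ?addr0 => [|j ji].
    rewrite hornerZ LE /lagrange_weight big1 ?mulr1 ?subrr // => j ji.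
    by rewrite mulVf // subr_eq0 (inj_eq a_inj) eq_sym.
  rewrite hornerZ LE /lagrange_weight (bigD1 i) 1?eq_sym //=.
  by rewrite subrr mulr0 mul0r mulr0.
have q0 : q = 0.
  apply/eqP/negPn/negP => q_neq0.
  have := max_poly_roots (rs := map a (enum I)) q_neq0.
  rewrite (map_inj_uniq a_inj) enum_uniq size_map -cardE ltnNge szq.
  move=> /(_ _ isT) contra; suff /contra : all (root q) (map a (enum I)) by [].
  by apply/allP => _ /mapP [i _ ->]; apply/rootP.
move/eqP: q0; rewrite subr_eq0 => /eqP pE.
rewrite [in LHS]pE horner_sum; apply: eq_bigr => i _.
by rewrite hornerZ LE mulrC.
Qed.

(** * Straight-line programs for linear combinations *)

Definition operand_bound (F I : Type) (r : nat) (u : operand F I) : bool :=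
  if u is Reg k then (k < r)%N else true.

Lemma operand_bound_leq (F I : Type) (r r' : nat) (u : operand F I) :
  (r <= r')%N -> operand_bound r u -> operand_bound r' u.
Proof. by case: u => //= k le_rr' /leq_trans->. Qed.

Lemma operand_eval_cat (F : fieldType) (I : Type) (inp : I -> F)
    (regs new : seq F) (u : operand F I) :
  operand_bound (size regs) u ->
  operand_eval inp (regs ++ new) u = operand_eval inp regs u.
Proof. by case: u => //= k ltk; rewrite nth_cat ltk. Qed.

Lemma size_foldl_step (F : fieldType) (I : Type) (inp : I -> F)
    (c : seq (instruction F I)) (regs : seq F) :
  size (foldl (step inp) regs c) = (size regs + size c)%N.
Proof.
elim: c regs => [|o c IHc] regs /=; first by rewrite addn0.
by rewrite IHc size_rcons addnS.
Qed.

(** A register out of range reads 0 and may change value once more code runs; [operand_bound] rules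
    this out, so programs can be concatenated. *)
Lemma operand_eval_foldl (F : fieldType) (I : Type) (inp : I -> F)
    (c : seq (instruction F I)) (regs : seq F) (u : operand F I) :
  operand_bound (size regs) u ->
  operand_eval inp (foldl (step inp) regs c) u = operand_eval inp regs u.
Proof.
elim: c regs => [//|o c IHc] regs bu /=.
rewrite IHc ?size_rcons; last exact: operand_bound_leq bu.
by rewrite /step -cats1 operand_eval_cat.
Qed.

(** Register numbers are absolute, so the code is generated for a start with r registers already
    filled. *)
Lemma lincomb_code (F : fieldType) (I : Type) (r : nat) (ts : seq (F * I)) :
  exists (c : seq (instruction F I)) (u : operand F I),
    [/\ size c = (2 * size ts)%N, operand_bound (r + size c) u &
      forall (inp : I -> F) (regs : seq F), size regs = r ->
        operand_eval inp (foldl (step inp) regs c) u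
        = \sum_(t <- ts) t.1 * inp t.2].
Proof.
elim: ts => [|[a i] ts [c [u [szc bu uP]]]].
  by exists [::], (Const _ 0); split=> // inp regs _; rewrite big_nil.
(* Register [r + size c] receives the product and the next one adds the tail's value [u]: two
   instructions per term, none for the empty sum. *)
exists (c ++ [:: Instruction OpMul (Const _ a) (Input _ i);
                 Instruction OpAdd (Reg _ _ (r + size c)) u]).
exists (Reg _ _ (r + size c).+1); split=> [||inp regs szr].
- by rewrite size_cat szc /= addn2 mulnS.
- by rewrite /= size_cat addnA addn2.
have szf : size (foldl (step inp) regs c) = (r + size c)%N.
  by rewrite size_foldl_step szr.
rewrite foldl_cat /= /step /= nth_rcons size_rcons szf ltnn eqxx.
rewrite nth_rcons szf ltnn eqxx big_cons /= -(uP inp regs szr); congr (_ + _).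
by rewrite -cats1 operand_eval_cat // szf.
Qed.

Lemma lincombs_code (F : fieldType) (I : Type) (tss : seq (seq (F * I))) :
  exists (c : seq (instruction F I)) (us : seq (operand F I)),
    [/\ size c = (\sum_(ts <- tss) 2 * size ts)%N, size us = size tss,
      all (operand_bound (size c)) us &
      forall inp : I -> F,
        map (operand_eval inp (foldl (step inp) [::] c)) us
        = [seq \sum_(t <- ts) t.1 * inp t.2 | ts <- tss]].
Proof.
elim/last_ind: tss => [|tss ts [c [us [szc szus bus usP]]]].
  by exists [::], [::]; rewrite big_nil.
have [c' [u [szc' bu uP]]] := lincomb_code (size c) ts.
exists (c ++ c'), (rcons us u); split=> [||| inp].
- by rewrite size_cat szc szc' big_rcons.
- by rewrite !size_rcons szus.
- rewrite all_rcons size_cat bu /=; apply: sub_all bus => v.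
  by apply: operand_bound_leq; rewrite leq_addr.
rewrite !map_rcons foldl_cat uP ?size_foldl_step // -usP; congr rcons.
elim: us bus {szus usP} => //= v us IHus /andP [bv /IHus ->].
by rewrite operand_eval_foldl // size_foldl_step.
Qed.

(** The selector [f] lets each output read its own [#|I|] inputs out of [J], so that the cost does
    not grow with the total number of inputs. *)
Lemma lincombs_slp (F : fieldType) (I : finType) (J : Type) (n : nat)
    (a : 'I_n -> I -> F) (f : 'I_n -> I -> J) :
  exists2 p : slp F J n, slp_cost p = (2 * #|I| * n)%N &
    forall inp : J -> F,
      slp_eval p inp = \row_k \sum_i a k i * inp (f k i).
Proof.
pose tss := [seq [seq (a k i, f k i) | i <- enum I] | k <- enum 'I_n].
have [c [us [szc szus _ usP]]] := lincombs_code tss.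
exists (Slp c (fun k : 'I_n => nth (Const _ 0) us k)) => [|inp].
  rewrite /slp_cost szc big_map big_enum /=.
  under eq_bigr do rewrite size_map -cardE.
  by rewrite sum_nat_const card_ord mulnC.
have sztss : size tss = n by rewrite size_map size_enum_ord.
apply/rowP => k; rewrite !mxE -(nth_map _ 0) ?szus ?sztss // usP.
by rewrite (nth_map [::]) ?sztss // (nth_map k) ?size_enum_ord // nth_ord_enum
  big_map big_enum.
Qed.

(** * Decimation of the transform in polynomial form *)

Lemma dft_horner (F : fieldType) (s : nat) (w : F) (x : 'rV[F]_s) (k : 'I_s) :
  dft w x 0 k = (rVpoly x).[w ^+ k].
Proof.
rewrite mxE horner_poly; apply: eq_bigr => j _.
by rewrite insubT // => ltj; rewrite -exprM; congr (x 0 _ * _); apply: val_inj.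
Qed.

Definition block_poly (F : fieldType) (m s : nat) (x : 'rV[F]_s) (l : nat) :
    {poly F} :=
  \poly_(j < m) (rVpoly x)`_(l * m + j).

(** The polynomial P_l. When m divides s, it is the remainder of [rVpoly x] modulo X^m - w^(m l). *)
Definition folded_poly (F : fieldType) (m s : nat) (w : F) (x : 'rV[F]_s)
    (l : nat) : {poly F} :=
  \sum_(i < s %/ m) (w ^+ m) ^+ (l * i) *: block_poly m x i.

Lemma size_folded_poly (F : fieldType) (m s : nat) (w : F) (x : 'rV[F]_s)
    (l : nat) :
  (size (folded_poly m w x l) <= m)%N.
Proof.
rewrite (leq_trans (size_sum _ _ _)) //; apply/bigmax_leqP => i _.
exact: leq_trans (size_scale_leq _ _) (size_poly _ _).
Qed.

(** If k = l modulo s/m, then w^k is a root of X^m - w^(m l), so reducing modulo this binomial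
    preserves the value at w^k. *)
Lemma dft_folded_poly (F : fieldType) (m s : nat) (w : F) (x : 'rV[F]_s)
    (k : 'I_s) :
    (m %| s)%N -> w ^+ s = 1 ->
  dft w x 0 k = (folded_poly m w x (k %% (s %/ m))).[w ^+ k].
Proof.
move=> dvdms ws; have tm : (s %/ m * m)%N = s by rewrite divnK.
have wmt : (w ^+ m) ^+ (s %/ m) = 1 by rewrite -exprM mulnC tm.
rewrite dft_horner horner_sum (horner_coef_wide _ (size_poly _ _)).
(* The sum over s coefficients is cut into s/m consecutive runs of length m. *)
rewrite -(big_mkord xpredT (fun j => (rVpoly x)`_j * (w ^+ k) ^+ j)).
rewrite -[X in index_iota _ X]tm big_nat_mul big_mkord.
apply: eq_bigr => i _.
rewrite mulSn -{1}[(i * m)%N]add0n big_addn addnK big_mkord.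
rewrite hornerZ horner_poly mulr_sumr; apply: eq_bigr => j _.
rewrite addnC mulrCA; congr (_ * _); rewrite exprD; congr (_ * _).
rewrite [in RHS]exprM expr_mod // -!exprM.
by rewrite [in RHS]mulnC mulnA.
Qed.

(** * The strategy, its decoder and its optimality *)

Definition folded_strategy (F : fieldType) (N m s : nat) (w : F)
    (a : 'I_N -> F) : strategy F N m s :=
  Strategy (fun i x => \row_l (block_poly m x l).[a i])
           (fun _ => dft (w ^+ m)).

Lemma worker_output_folded (F : fieldType) (N m s : nat) (w : F)
    (a : 'I_N -> F) (x : 'rV[F]_s) (i : 'I_N) (l : 'I_(s %/ m)) :
  worker_output (folded_strategy m s w a) x i 0 l
  = (folded_poly m w x l).[a i].
Proof.
rewrite mxE horner_sum; apply: eq_bigr => j _.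
by rewrite mxE hornerZ mulrC.
Qed.

Lemma folded_strategy_decoder (F : fieldType) (N m s : nat) (w : F)
    (a : 'I_N -> F) (S : {set 'I_N}) :
    (0 < m)%N -> (m %| s)%N -> w ^+ s = 1 -> injective a -> #|S| = m ->
  exists (d : results F m s S -> 'rV[F]_s)
         (p : slp F ({i : 'I_N | i \in S} * 'I_(s %/ m)) s),
    [/\ decodes w (folded_strategy m s w a) d, slp_computes p d
      & slp_cost p = (2 * m * s)%N].
Proof.
move=> m_gt0 dvdms ws a_inj cardS.
have t_gt0 (k : 'I_s) : (0 < s %/ m)%N.
  by rewrite divn_gt0 // dvdn_leq // (leq_ltn_trans _ (ltn_ord k)).
pose b (i : {i : 'I_N | i \in S}) := a (val i).
have b_inj : injective b by move=> i j /a_inj /val_inj.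
have cardI : #|{: {i : 'I_N | i \in S}}| = m by rewrite card_sig -cardS.
(* The weights depend only on w, k and the nodes of S, so they are free constants. Output k reads
   entry k mod s/m of each result. *)
have [p costp pP] := lincombs_slp
  (fun k : 'I_s => lagrange_weight b (w ^+ k))
  (fun k i => (i, Ordinal (ltn_pmod k (t_gt0 k)))).
pose d (y : results F m s S) := slp_eval p (fun il => y il.1 0 il.2).
exists d, p; split=> // [x|]; last by rewrite costp cardI.
apply/rowP => k; rewrite /d pP mxE (dft_folded_poly _ _ dvdms ws).
rewrite (lagrange_horner _ b_inj) ?cardI ?size_folded_poly //.
by apply: eq_bigr => i _; rewrite ffunE worker_output_folded.
Qed.

Lemma folded_strategy_not_recoverable (F : fieldType) (N m s : nat) (w : F)
    (a : 'I_N -> F) (k : nat) :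
    (k < m)%N -> (m <= s)%N -> (k <= N)%N -> s.-primitive_root w ->
  ~ recoverable w (folded_strategy m s w a) k.
Proof.
move=> ltkm lems lekN prim_w rec.
have [S cardS] : exists S : {set 'I_N}, #|S| = k.
  exists [set widen_ord lekN i | i : 'I_k].
  by rewrite card_imset ?card_ord // => i j [eq_ij]; apply: val_inj.
have [d dP] := rec S cardS.
pose q : {poly F} := \prod_(c <- map a (enum S)) ('X - c%:P).
have szq : size q = k.+1 by rewrite size_prod_XsubC size_map -cardE cardS.
pose x : 'rV[F]_s := poly_rV q.
have xq : rVpoly x = q by rewrite poly_rV_K // szq (leq_trans ltkm).
(* As deg q = k < m, block 0 is q itself, which vanishes at the nodes of S, and all later blocks are
   zero. *)
have block0 i : i \in S -> forall l, (block_poly m x l).[a i] = 0.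
  move=> iS [|l].
    have -> : block_poly m x 0 = q.
      apply/polyP => j; rewrite coef_poly xq add0n; case: ltnP => // lemj.
      by rewrite nth_default // szq (leq_trans ltkm).
    apply/rootP; by rewrite root_prod_XsubC map_f ?mem_enum.
  rewrite /block_poly horner_poly big1 // => j _.
  rewrite xq nth_default ?mul0r // szq mulSn -addnA.
  exact: leq_trans ltkm (leq_addr _ _).
have out0 i : i \in S -> worker_output (folded_strategy m s w a) x i
    = worker_output (folded_strategy m s w a) 0 i.
  move=> iS; congr dft; apply/rowP => l; rewrite !mxE block0 //.
  by rewrite horner_poly big1 // => j _; rewrite linear0 coef0 mul0r.
(* The decoder sees the same results for [x] and for the zero input. *)
have dft0 : dft w x = dft w 0.
  by rewrite -!dP; congr d; apply/ffunP => i; rewrite !ffunE out0 // (valP i).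
have q_neq0 : q != 0 by rewrite -size_poly_gt0 szq.
(* Primitivity of w makes its s powers distinct; all would be roots of q, whose degree k is below
   s. *)
have := max_poly_roots (rs := [seq w ^+ j | j : 'I_s <- enum 'I_s]) q_neq0.
rewrite size_map size_enum_ord szq ltnS leqNgt (leq_trans ltkm lems).
move=> H; suff: false by []; apply: H.
  apply/allP => _ /mapP [j _ ->]; apply/rootP.
  by rewrite -xq -dft_horner dft0 dft_horner linear0 horner0.
rewrite map_inj_uniq ?enum_uniq // => i j /eqP.
rewrite (eq_prim_root_expr prim_w) !modn_small // => /eqP; exact: val_inj.
Qed.

Theorem theorem1 (m N : nat) (hm : (0 < m)%N) (hmN : (m <= N)%N) :
  exists C : nat,
    forall (s : nat) (F : fieldType) (w : F),
      (0 < s)%N -> (m %| s)%N ->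
      s.-primitive_root w ->
      (forall e : seq F, Finite.axiom e -> (N <= size e)%N) ->
      exists st : strategy F N m s,
        is_recovery_threshold w st m /\
        (forall S : {set 'I_N}, #|S| = m ->
           exists (d : results F m s S -> 'rV[F]_s)
                  (p : slp F ({i : 'I_N | i \in S} * 'I_(s %/ m)) s),
             [/\ decodes w st d, slp_computes p d & (slp_cost p <= C * s)%N]).
Proof.
(* One multiplication and one addition for each of the m results entering an output. *)
exists (2 * m)%N => s F w s_gt0 dvdms prim_w cardF.
have [u Uu szu] := uniq_seq_of_enum_bound cardF.
pose a (i : 'I_N) : F := u`_i.
have a_inj : injective a.
  move=> i j /eqP; rewrite nth_uniq ?szu // => /eqP; exact: val_inj.
have decoder S := @folded_strategy_decoder F N m s w a S hm dvdms
  (prim_expr_order prim_w) a_inj.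
exists (folded_strategy m s w a); split; first split=> //.
- by move=> S /decoder [d [p [dP _ _]]]; exists d.
- move=> k lekN; rewrite leqNgt; apply: contraPN => ltkm.
  by apply: folded_strategy_not_recoverable => //; apply: dvdn_leq.
by move=> S /decoder [d [p [dP pP costp]]]; exists d, p; rewrite costp.
Qed.
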